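(* Let $\alpha>0$, let $I\subset\mathbb{R}$ be an interval, and let $a,b,c,A,B,C$ and $u,v$ be real-valued functions on $I$ such that all derivatives occurring in the identity below (including those in $l[u]$ and $L[v]$) exist on $I$. If neither $v(x)$ nor $v'(x)$ vanishes anywhere in $I$, then the following identity holds on $I$: $$ \begin{aligned} &\frac{d}{dx}\Big\{\frac{u}{\varphi(v)}\big[\varphi(u)(A\varphi(v''))'-\varphi(v)(a\varphi(u''))'\big]+\frac{u'}{\varphi(v')}\big[\varphi(v')\,a\varphi(u'')-\varphi(u')\,A\varphi(v'')\big]+\frac{u}{\varphi(v)}\big[\varphi(v)\,b\varphi(u')-\varphi(u)\,B\varphi(v')\big]\Big\}\\ &=(a-A)|u''|^{\alpha+1}+(b-B)|u'|^{\alpha+1}+(c-C)|u|^{\alpha+1}\\ &\quad+A\Big[|u''|^{\alpha+1}+\alpha\Big|u'\frac{v''}{v'}\Big|^{\alpha+1}-(\alpha+1)u''\varphi\Big(u'\frac{v''}{v'}\Big)\Big]\\ &\quad+\big[B|v'|^{\alpha+1}-v'(A\varphi(v''))'\big]\Big[\Big|\frac{u'}{v'}\Big|^{\alpha+1}+\alpha\Big|\frac{u}{v}\Big|^{\alpha+1}-(\alpha+1)\frac{u'}{v'}\varphi\Big(\frac{u}{v}\Big)\Big]\\ &\quad+\frac{u}{\varphi(v)}\big\{\varphi(u)\,L[v]-\varphi(v)\,l[u]\big\}. \end{aligned} $$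
   Context: For $\alpha>0$, $\varphi(s)=|s|^{\alpha-1}s$ for $s\in\mathbb{R}$, with $\varphi(0)=0$. A prime denotes $d/dx$. The half-linear fourth-order operators are $$l[u]=[a(x)\varphi(u'')]''-[b(x)\varphi(u')]'+c(x)\varphi(u),\qquad L[v]=[A(x)\varphi(v'')]''-[B(x)\varphi(v')]'+C(x)\varphi(v).$$ The requirement that all derivatives occurring exist means in particular that $u,v$ are twice differentiable, that $a\varphi(u'')$ and $A\varphi(v'')$ are twice differentiable, and that $b\varphi(u')$ and $B\varphi(v')$ are differentiable. *)

(* Defs.v *)
From mathcomp Require Import all_boot all_order all_algebra.
From mathcomp Require Import all_classical all_reals all_analysis.

Set Implicit Arguments.
Unset Strict Implicit.
Unset Printing Implicit Defensive.

Import Order.TTheory GRing.Theory Num.Theory.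
Import numFieldNormedType.Exports.

Local Open Scope classical_set_scope.
Local Open Scope ring_scope.

(* Derivatives are taken relative to a set I: the difference quotient
   at x is restricted to points of I other than x, so the derivative is
   two-sided at interior points of an interval and one-sided at an endpoint
   belonging to it.  Values of f outside I play no role: a total function
   R -> R stands for a function on I. *)
Definition diff_quot_on (R : realType) (I : set R) (f : R -> R) (x : R) :
    set_system R :=
  (fun y : R => (f y - f x) / (y - x)) @ within I x^'.

Definition derivable_on (R : realType) (I : set R) (f : R -> R) : Prop :=
  forall x : R, I x -> cvg (diff_quot_on I f x).

(* A `lim`, hence meaningful only where the difference quotient converges. *)
Definition derive_on (R : realType) (I : set R) (f : R -> R) : R -> R :=
  fun x : R => lim (diff_quot_on I f x).

(* At s = 0 the factor s makes this 0, for every real alpha. *)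
Definition phi (R : realType) (alpha s : R) : R := `|s| `^ (alpha - 1) * s.

(* a phi(u'') *)
Definition hl_moment (R : realType) (I : set R) (alpha : R) (a u : R -> R) :
    R -> R :=
  fun x => a x * phi alpha (derive_on I (derive_on I u) x).

(* b phi(u') *)
Definition hl_flux (R : realType) (I : set R) (alpha : R) (b u : R -> R) :
    R -> R :=
  fun x => b x * phi alpha (derive_on I u x).

(* l[u] = (a phi(u''))'' - (b phi(u'))' + c phi(u) *)
Definition half_linear_op (R : realType) (I : set R) (alpha : R)
    (a b c u : R -> R) : R -> R :=
  fun x => derive_on I (derive_on I (hl_moment I alpha a u)) x
           - derive_on I (hl_flux I alpha b u) x
           + c x * phi alpha (u x).

(* Exactly the derivatives that occur in half_linear_op; the coefficients
   themselves and c phi(u) need not be differentiable. *)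
Definition half_linear_domain (R : realType) (I : set R) (alpha : R)
    (a b u : R -> R) : Prop :=
  [/\ derivable_on I u,
      derivable_on I (derive_on I u),
      derivable_on I (hl_moment I alpha a u),
      derivable_on I (derive_on I (hl_moment I alpha a u)) &
      derivable_on I (hl_flux I alpha b u)].

(* Main.v *)
Require Import Defs.
From mathcomp Require Import all_boot all_order all_algebra.
From mathcomp Require Import all_classical all_reals all_analysis.
From mathcomp Require Import ring lra.

Import Order.TTheory GRing.Theory Num.Theory.
Import numFieldNormedType.Exports.

Local Open Scope classical_set_scope.
Local Open Scope ring_scope.

Set Implicit Arguments.
Unset Strict Implicit.
Unset Printing Implicit Defensive.

(** With G(s) = s phi(s) = |s|^(alpha+1), and with P, M, F standing for the
    derivative of the moment, the moment and the flux, the expression under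
    the derivative is, on I,
<<
  Q * (P_v - F_v) + u * (F_u - P_u) + u' * M_u - Q_1 * M_v,
  Q = G(u) / phi(v),   Q_1 = G(u') / phi(v').
>>
    Only Q and Q_1 are not directly given as differentiable.  In general phi
    fails to be differentiable at 0 when alpha < 1, and u, u' may vanish; but
    G is differentiable everywhere, with derivative (alpha + 1) phi
    ([is_derive_mulphi]), and 1 / phi is differentiable away from 0
    ([is_derive_invphi]).  The product and chain rules then give
<<
  dQ/dx = (alpha + 1) phi(u/v) u' - alpha G(u/v) v'
>>
    ([picone_quotient_derivative]), and the same for Q_1 with u', v' in place
    of u, v.  Differentiating the sum by the product rule leaves an identity
    between real numbers at a fixed point, which holds because phi is
    multiplicative and G(s) = s phi(s) ([picone_pointwise]).

    Derivatives are relative to I, hence one-sided at an endpoint, so the sum,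
    product and chain rules are established for limits of difference quotients
    along the points of I other than x.  These limits are unique because x is
    not isolated in a nondegenerate interval ([within_dnbhs_proper]). *)

(** * Derivatives relative to a set *)

Definition has_derivative_on {R : realType} (I : set R) (f : R -> R)
    (x l : R) : Prop :=
  diff_quot_on I f x --> l.

(** Every ball around [x] meets the segment from [x] to [y] at a point other
    than [x], and that segment lies in [I]. *)
Lemma within_dnbhs_proper {R : realType} (I : set R) (x y : R) :
  is_interval I -> I x -> I y -> y != x -> ProperFilter (within I x^').
Proof.
move=> itvI Ix Iy yx; apply: Build_ProperFilter_ex => P /nbhs_ballP[e /= e0 eP].
have {}eP z : `|x - z| < e -> z != x -> I z -> P z by move=> ?; exact: eP.
case: (ltgtP y x) yx => // [yx|xy] _.
- exists (Num.max y (x - e / 2)).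
  have [yz ez] : y <= Num.max y (x - e / 2)
      /\ x - e / 2 <= Num.max y (x - e / 2).
    by rewrite !le_max !lexx orbT.
  have zx : Num.max y (x - e / 2) < x by rewrite gt_max yx/=; lra.
  apply: eP; [by rewrite gtr0_norm; lra|by rewrite lt_eqF|].
  by apply: (itvI y x) => //; rewrite yz ltW.
- exists (Num.min y (x + e / 2)).
  have [zy ze] : Num.min y (x + e / 2) <= y
      /\ Num.min y (x + e / 2) <= x + e / 2.
    by rewrite !ge_min !lexx orbT.
  have xz : x < Num.min y (x + e / 2) by rewrite lt_min xy/=; lra.
  apply: eP; [by rewrite ltr0_norm; lra|by rewrite gt_eqF|].
  by apply: (itvI x y) => //; rewrite zy ltW.
Qed.

Section relative_calculus.
Context {R : realType} (I : set R).
Implicit Types (f g h : R -> R) (x l m d : R).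

Lemma derivable_on_has_derivative f x :
  derivable_on I f -> I x -> has_derivative_on I f x (derive_on I f x).
Proof. by move=> df Ix; exact: df. Qed.

Lemma derive_on_unique f x l : ProperFilter (within I x^') ->
  has_derivative_on I f x l -> derive_on I f x = l.
Proof. by move=> PF; apply: cvg_lim; exact: norm_hausdorff. Qed.

Lemma has_derivative_on_eq f g x l : I x -> (forall y, I y -> f y = g y) ->
  has_derivative_on I f x l -> has_derivative_on I g x l.
Proof.
move=> Ix fg; apply: cvg_trans; apply: near_eq_cvg.
by rewrite near_withinE; apply: nearW => y Iy; rewrite !fg.
Qed.

(** Reduces each differentiation rule below to exhibiting a slope function and
    computing its limit. *)
Lemma has_derivative_on_slope f x l q :
  (forall y, I y -> y != x -> f y - f x = q y * (y - x)) ->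
  q y @[y --> within I x^'] --> l -> has_derivative_on I f x l.
Proof.
move=> fq; apply: cvg_trans; apply: near_eq_cvg.
rewrite near_withinE /dnbhs near_withinE; apply: nearW => y yx Iy.
by rewrite fq// mulfK// subr_eq0.
Qed.

Lemma has_derivative_on_cvg f x l : has_derivative_on I f x l ->
  f y @[y --> within I x^'] --> f x.
Proof.
move=> fl.
have yx : (y : R) @[y --> within I x^'] --> x.
  by apply: cvg_trans; first apply: cvg_within; exact: cvg_within.
have : f x + (f y - f x) / (y - x) * (y - x) @[y --> within I x^']
       --> f x + l * (x - x).
  by apply: cvgD; [exact: cvg_cst|apply: cvgM => //; apply: cvgB => //;
     exact: cvg_cst].
rewrite subrr mulr0 addr0; apply: cvg_trans; apply: near_eq_cvg.
rewrite near_withinE /dnbhs near_withinE; apply: nearW => y /= yx' Iy.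
by rewrite divfK ?subr_eq0// addrC subrK.
Qed.

Lemma has_derivative_onD f g x l m :
  has_derivative_on I f x l -> has_derivative_on I g x m ->
  has_derivative_on I (fun y => f y + g y) x (l + m).
Proof.
move=> fl gm; apply: has_derivative_on_slope; last exact: cvgD fl gm.
by move=> y _ yx; rewrite mulrDl !divfK ?subr_eq0//; ring.
Qed.

Lemma has_derivative_onN f x l :
  has_derivative_on I f x l -> has_derivative_on I (fun y => - f y) x (- l).
Proof.
move=> fl; apply: has_derivative_on_slope; last exact: cvgN fl.
by move=> y _ yx; rewrite mulNr !divfK ?subr_eq0//; ring.
Qed.

Lemma has_derivative_onM f g x l m :
  has_derivative_on I f x l -> has_derivative_on I g x m ->
  has_derivative_on I (fun y => f y * g y) x (l * g x + f x * m).
Proof.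
move=> fl gm; have gc := has_derivative_on_cvg gm.
apply: has_derivative_on_slope; last first.
  by apply: cvgD; [exact: cvgM fl gc|apply: cvgM gm; exact: cvg_cst].
by move=> y _ yx /=; field; rewrite subr_eq0.
Qed.

(** The outer function is differentiated in the ordinary two-sided sense.  Its
    Caratheodory slope is defined at every point, so [f y = f x] for [y]
    arbitrarily close to [x] is harmless. *)
Lemma has_derivative_on_comp h f x l d :
  is_derive (f x) 1 h d -> has_derivative_on I f x l ->
  has_derivative_on I (h \o f) x (d * l).
Proof.
move=> /is_derive1_caratheodory[s [hs sc <-]] fl.
have fc := has_derivative_on_cvg fl.
apply: has_derivative_on_slope; last first.
  by apply: cvgM fl; exact: continuous_cvg sc fc.
by move=> y _ yx /=; rewrite hs -mulrA divfK// subr_eq0.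
Qed.

End relative_calculus.

(** * The function phi and its derivatives *)

Section phi_theory.
Context {R : realType} (alpha : R).
Implicit Types s t : R.
Local Notation phi := (phi alpha).

Lemma phi0 : phi 0 = 0. Proof. by rewrite /phi mulr0. Qed.

Lemma phiM s t : phi (s * t) = phi s * phi t.
Proof. by rewrite /phi normrM powRM//; ring. Qed.

Lemma phi_eq0 t : (phi t == 0) = (t == 0).
Proof.
rewrite /phi mulf_eq0; case: (eqVneq t 0) => [|t0]; rewrite ?orbT ?orbF//.
by apply/negbTE; rewrite gt_eqF// powR_gt0// normr_gt0.
Qed.

Lemma phi_div s t : phi (s / t) = phi s / phi t.
Proof.
have [->|t0] := eqVneq t 0; first by rewrite invr0 mulr0 phi0 invr0 mulr0.
by apply: (canRL (mulfK _)); rewrite ?phi_eq0// -phiM divfK.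
Qed.

Lemma phi_gt0E t : 0 < t -> phi t = t `^ alpha.
Proof.
move=> t0; rewrite /phi gtr0_norm// mulrC -{1}[t]powRr1 ?ltW// -powRD.
  by congr powR; ring.
by apply/implyP => _; rewrite gt_eqF.
Qed.

Hypothesis alpha_gt0 : 0 < alpha.

Lemma powR_mulphi t : `|t| `^ (alpha + 1) = t * phi t.
Proof.
have [->|t0] := eqVneq t 0.
  by rewrite normr0 mul0r powR0// gt_eqF// addr_gt0.
rewrite /phi mulrCA -expr2 -real_normK ?num_real// -powR_mulrn// -powRD.
  by congr powR; ring.
by apply/implyP => _; rewrite normr_eq0.
Qed.

(** Near [t] the ratio [y / t] is positive, so by multiplicativity
    [phi y = phi t * (y / t) `^ alpha], which reduces both signs of [t] to
    the derivative of a power at 1. *)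
Lemma is_derive_phi t : t != 0 -> is_derive t 1 phi (alpha * phi t / t).
Proof.
move=> t0.
apply: (@near_eq_is_derive R R R (fun y : R => phi t * (y / t) `^ alpha)).
  have yt1 : y / t @[y --> t] --> (1 : R).
    by rewrite -(divff t0); apply: cvgM => //; exact: cvg_cst.
  have near_gt0 : \forall y \near t, 0 < y / t by exact: (cvgr_gt _ yt1 _ ltr01).
  near=> y; have yt0 : 0 < y / t by near: y.

  by rewrite -phi_gt0E// -phiM mulrC divfK.
have dpow : is_derive (t / t) 1 (fun s : R => s `^ alpha) alpha.
  rewrite divff//; apply: is_derive_eq (is_derive1_powR alpha ltr01) _.
  by rewrite powR1 mulr1.
have dscale : is_derive t 1 (fun y : R => y / t) t^-1.
  have := is_deriveM (is_derive_id t 1) (is_derive_cst t^-1 t 1).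
  by rewrite scaler0 add0r => /is_derive_eq; apply; rewrite /GRing.scale/= mulr1.
have dcomp := is_derive1_comp (g := fun y => y / t) dpow dscale.
have := is_deriveZ (phi t) dcomp.
by move=> /is_derive_eq; apply; rewrite /GRing.scale/=; ring.
Unshelve. all: by end_near. Qed.

Lemma phi_continuous0 : {for (0 : R), continuous phi}.
Proof.
rewrite /prop_for /continuous_at phi0.
apply/cvgrPdist_lt => e e0.
have e'0 : 0 < e `^ alpha^-1 by rewrite powR_gt0.
near=> s; rewrite sub0r normrN.
have [->|s0] := eqVneq s 0; first by rewrite phi0 normr0.
have -> : `|phi s| = `|s| `^ alpha.
  by rewrite -phi_gt0E ?normr_gt0// /phi normrM norm_powR// !normr_id.
have -> : e = (e `^ alpha^-1) `^ alpha.
  by rewrite -powRrM mulVf ?gt_eqF// powRr1// ltW.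
apply: gt0_ltr_powR => //; rewrite ?nnegrE ?powR_ge0//.
Unshelve. all: by end_near. Qed.

(** This is the derivative of |s|^(alpha+1), and it exists at 0 too: there the
    slope of [s * phi s] is [phi] itself, which is continuous at 0. *)
Lemma is_derive_mulphi t :
  is_derive t 1 (fun s => s * phi s) ((alpha + 1) * phi t).
Proof.
have [->|t0] := eqVneq t 0.
  apply/is_derive1_caratheodory; exists phi; split.
  - by move=> s; rewrite mul0r !subr0 mulrC.
  - exact: phi_continuous0.
  - by rewrite phi0 mulr0.
have := is_deriveM (is_derive_id t 1) (is_derive_phi t0).
by move=> /is_derive_eq; apply; rewrite /GRing.scale/=; field.
Qed.

Lemma is_derive_invphi t : t != 0 ->
  is_derive t 1 (fun s => (phi s)^-1) (- (alpha / (t * phi t))).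
Proof.
move=> t0; have pt0 : phi t != 0 by rewrite phi_eq0.
apply: is_derive_eq (is_deriveV pt0 (is_derive_phi t0)) _.
by rewrite /GRing.scale/=; field; rewrite t0 pt0.
Qed.

(** * Picone's identity *)

Lemma picone_quotient_derivative (I : set R) (f g : R -> R) (x l m : R) :
  g x != 0 -> has_derivative_on I f x l -> has_derivative_on I g x m ->
  has_derivative_on I (fun y => f y * phi (f y) / phi (g y)) x
    ((alpha + 1) * phi (f x / g x) * l
     - alpha * (f x / g x * phi (f x / g x)) * m).
Proof.
move=> g0 fl gm; have pg0 : phi (g x) != 0 by rewrite phi_eq0.
have := has_derivative_onM (has_derivative_on_comp (is_derive_mulphi (f x)) fl)
                           (has_derivative_on_comp (is_derive_invphi g0) gm).
congr has_derivative_on; rewrite /= !phi_div; field; by rewrite g0 pg0.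
Qed.

(** The left-hand side is the derivative as the product rule delivers it.  Here
    [Ma'], [Ma''], [MA'], [MA''] stand for the first and second derivatives of
    the moments and [Fb'], [FB'] for the first derivatives of the fluxes.
    Once [phi] is distributed over products and quotients, its values are
    independent unknowns of a rational identity. *)
Lemma picone_pointwise (a A b B c C u u' u'' v v' v'' : R)
    (Ma' Ma'' MA' MA'' Fb' FB' : R) : v != 0 -> v' != 0 ->
  ((alpha + 1) * phi (u / v) * u' - alpha * (u / v * phi (u / v)) * v')
    * (MA' - B * phi v')
  + u * phi u / phi v * (MA'' - FB')
  + (u' * (b * phi u' - Ma') + u * (Fb' - Ma''))
  + (u'' * (a * phi u'') + u' * Ma'
     - (((alpha + 1) * phi (u' / v') * u''
         - alpha * (u' / v' * phi (u' / v')) * v'') * (A * phi v'')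
        + u' * phi u' / phi v' * MA')) =
    (a - A) * `|u''| `^ (alpha + 1)
  + (b - B) * `|u'| `^ (alpha + 1)
  + (c - C) * `|u| `^ (alpha + 1)
  + A * (`|u''| `^ (alpha + 1)
         + alpha * `|u' * (v'' / v')| `^ (alpha + 1)
         - (alpha + 1) * u'' * phi (u' * (v'' / v')))
  + (B * `|v'| `^ (alpha + 1) - v' * MA')
    * (`|u' / v'| `^ (alpha + 1)
       + alpha * `|u / v| `^ (alpha + 1)
       - (alpha + 1) * (u' / v') * phi (u / v))
  + u / phi v * (phi u * (MA'' - FB' + C * phi v)
                 - phi v * (Ma'' - Fb' + c * phi u)).
Proof.
move=> v0 v'0; rewrite !powR_mulphi// !(phi_div, phiM).
have : phi v != 0 by rewrite phi_eq0.
have : phi v' != 0 by rewrite phi_eq0.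
move: (phi v) (phi v') (phi v'') (phi u) (phi u') (phi u'').
by move=> pv pv' pv'' pu pu' pu'' pv'0 pv0; field; rewrite v0 v'0 pv0 pv'0.
Qed.

End phi_theory.

Unset Implicit Arguments.

Theorem mainTheorem2 (R : realType) (alpha : R) (I : set R)
    (a b c A B C u v : R -> R)
    (alpha_gt0 : 0 < alpha)
    (itvI : is_interval I)
    (nondegI : exists x y : R, [/\ I x, I y & x < y])
    (domu : half_linear_domain I alpha a b u)
    (domv : half_linear_domain I alpha A B v)
    (v_neq0 : forall x, I x -> v x != 0)
    (v'_neq0 : forall x, I x -> derive_on I v x != 0) :
  let φ := phi alpha in
  let u' := derive_on I u in
  let u'' := derive_on I u' in
  let v' := derive_on I v in
  let v'' := derive_on I v' in
  let aφu'' := fun x => a x * φ (u'' x) in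
  let Aφv'' := fun x => A x * φ (v'' x) in
  let lhs := fun x =>
      u x / φ (v x) * (φ (u x) * derive_on I Aφv'' x
                       - φ (v x) * derive_on I aφu'' x)
    + u' x / φ (v' x) * (φ (v' x) * (a x * φ (u'' x))
                         - φ (u' x) * (A x * φ (v'' x)))
    + u x / φ (v x) * (φ (v x) * (b x * φ (u' x))
                       - φ (u x) * (B x * φ (v' x))) in
  derivable_on I lhs /\
  forall x : R, I x ->
    derive_on I lhs x =
      (a x - A x) * `|u'' x| `^ (alpha + 1)
    + (b x - B x) * `|u' x| `^ (alpha + 1)
    + (c x - C x) * `|u x| `^ (alpha + 1)
    + A x * (`|u'' x| `^ (alpha + 1)
             + alpha * `|u' x * (v'' x / v' x)| `^ (alpha + 1)
             - (alpha + 1) * u'' x * φ (u' x * (v'' x / v' x)))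
    + (B x * `|v' x| `^ (alpha + 1) - v' x * derive_on I Aφv'' x)
      * (`|u' x / v' x| `^ (alpha + 1)
         + alpha * `|u x / v x| `^ (alpha + 1)
         - (alpha + 1) * (u' x / v' x) * φ (u x / v x))
    + u x / φ (v x) * (φ (u x) * half_linear_op I alpha A B C v x
                       - φ (v x) * half_linear_op I alpha a b c u x).
Proof.
move=> /=.
have [du ddu dMa dPa dFb] := domu; have [dv ddv dMA dPA dFB] := domv.
set lhs := (X in derivable_on I X).
set rhs := (X in forall x, I x -> derive_on I lhs x = X x).
suff main x : I x -> has_derivative_on I lhs x (rhs x).
  split=> x Ix; first by apply/cvg_ex; exists (rhs x); exact: main.
  apply: derive_on_unique (main _ Ix).
  have [y [z [Iy Iz yz]]] := nondegI.
  have [xy|yx] := eqVneq y x; last exact: within_dnbhs_proper yx.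
  by apply: (within_dnbhs_proper itvI Ix Iz); rewrite -xy gt_eqF.
move=> Ix.
have pv0 y : I y -> phi alpha (v y) != 0 by move=> Iy; rewrite phi_eq0 v_neq0.
have pv'0 y : I y -> phi alpha (derive_on I v y) != 0.
  by move=> Iy; rewrite phi_eq0 v'_neq0.
have Du := derivable_on_has_derivative du Ix.
have Dv := derivable_on_has_derivative dv Ix.
have Du' := derivable_on_has_derivative ddu Ix.
have Dv' := derivable_on_has_derivative ddv Ix.
have DMa := derivable_on_has_derivative dMa Ix.
have DMA := derivable_on_has_derivative dMA Ix.
have DPa := derivable_on_has_derivative dPa Ix.
have DPA := derivable_on_has_derivative dPA Ix.
have DFb := derivable_on_has_derivative dFb Ix.
have DFB := derivable_on_has_derivative dFB Ix.
have DQ := picone_quotient_derivative alpha_gt0 (v_neq0 _ Ix) Du Dv.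
have DQ' := picone_quotient_derivative alpha_gt0 (v'_neq0 _ Ix) Du' Dv'.
(* G(u)/phi(v) (P_v - F_v) + u (F_u - P_u) + u' M_u - G(u')/phi(v') M_v *)
have Dlhs :=
  has_derivative_onD
    (has_derivative_onD
       (has_derivative_onM DQ (has_derivative_onD DPA (has_derivative_onN DFB)))
       (has_derivative_onM Du (has_derivative_onD DFb (has_derivative_onN DPa))))
    (has_derivative_onD (has_derivative_onM Du' DMa)
       (has_derivative_onN (has_derivative_onM DQ' DMA))).
have -> : rhs x = _ := esym (picone_pointwise alpha_gt0
  (a x) (A x) (b x) (B x) (c x) (C x)
  (u x) (derive_on I u x) (derive_on I (derive_on I u) x)
  (derive_on I (derive_on I v) x)
  (derive_on I (hl_moment I alpha a u) x)
  (derive_on I (derive_on I (hl_moment I alpha a u)) x)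
  (derive_on I (hl_moment I alpha A v) x)
  (derive_on I (derive_on I (hl_moment I alpha A v)) x)
  (derive_on I (hl_flux I alpha b u) x) (derive_on I (hl_flux I alpha B v) x)
  (v_neq0 _ Ix) (v'_neq0 _ Ix)).
(* On I the given expression equals the sum that Dlhs differentiates, after
   phi(v) and phi(v') are cancelled. *)
apply: has_derivative_on_eq Ix _ Dlhs => y Iy.
rewrite /lhs -/(hl_moment I alpha A v) -/(hl_moment I alpha a u).
(* Naming the values at y turns the goal into an identity between rational
   expressions in independent unknowns. *)
move: (pv0 _ Iy) (pv'0 _ Iy).
move: (derive_on I (hl_moment I alpha A v) y).
move: (derive_on I (hl_moment I alpha a u) y) => Pa PA.
rewrite /hl_flux /hl_moment.
move: (phi alpha (v y)) (phi alpha (u y)) (phi alpha (derive_on I v y)).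
move: (phi alpha (derive_on I u y)).
move: (phi alpha (derive_on I (derive_on I u) y)).
move: (phi alpha (derive_on I (derive_on I v) y)).
move: (derive_on I u y) => u1 pv2 pu2 pu1 pv pu pv1 pv_neq0 pv1_neq0.
by field; rewrite pv_neq0 pv1_neq0.
Qed.
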